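(* Let $h\geq 3$ be an integer and let $L$ be a complete set of mutually orthogonal Latin squares of order $h+1$. Then the hypergraph $H_L$ is 2-e.c.
   Context: A Latin square of order $q$ is a $q\times q$ array on $q$ symbols in which each symbol occurs exactly once in each row and each column. Two Latin squares of the same order are orthogonal if, when superimposed, all $q^2$ ordered pairs of entries are distinct; a set of pairwise orthogonal Latin squares is a set of MOLS, and a complete set of MOLS of order $q$ is a set of $q-1$ MOLS of order $q$. Given a set $L$ of MOLS of order $h+1$, the $h$-uniform hypergraph $H_L$ is defined as follows: the vertex set consists of $(h+1)^2$ vertices arranged as the cells of an $(h+1)\times(h+1)$ array $A$; for each row and each column of $A$, every $h$-subset of the $h+1$ vertices in that row or column is an edge; and for each Latin square in $L$ and each symbol, taking the $(h+1)$-set of vertices of $A$ in the positions where that symbol occurs in that square, every $h$-subset of this set is an edge. An $h$-uniform hypergraph $H$ is $n$-e.c.\ if for every set $S\subseteq V(H)$ with $|S|=n$ and every $T\subseteq S$, there is $X\subseteq V(H)\setminus S$ with $|X|=h-1$ such that $X\cup\{z\}$ is an edge for every $z\in T$ and $X\cup\{s\}$ is not an edge for every $s\in S\setminus T$. *)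

(* Defs.v *)
From mathcomp Require Import all_boot all_algebra.

Set Implicit Arguments.
Unset Strict Implicit.
Unset Printing Implicit Defensive.

(* The vertices are all the elements of V. *)
Record uhypergraph (h : nat) (V : finType) := UHypergraph {
  edges : {set {set V}};
  edges_uniform : forall e : {set V}, e \in edges -> #|e| = h
}.

Definition n_ec (n h : nat) (V : finType) (H : uhypergraph h V) : Prop :=
  forall S T : {set V}, #|S| = n -> T \subset S ->
    exists X : {set V},
      [/\ X \subset ~: S, #|X| = h.-1,
          (forall z, z \in T -> X :|: [set z] \in edges H)
        & (forall s, s \in S :\: T -> X :|: [set s] \notin edges H)].

Definition latin_square (q : nat) (Sym : finType) (A : 'M[Sym]_q) : Prop :=
  [/\ #|Sym| = q,
      (forall (i : 'I_q) (s : Sym), exists! j : 'I_q, A i j = s)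
    & (forall (j : 'I_q) (s : Sym), exists! i : 'I_q, A i j = s)].

Definition orthogonal_squares (q : nat) (Sym : finType) (A B : 'M[Sym]_q) :
  Prop := injective (fun c : 'I_q * 'I_q => (A c.1 c.2, B c.1 c.2)).

Definition mols (q : nat) (Sym : finType) (L : {set 'M[Sym]_q}) : Prop :=
  (forall A, A \in L -> latin_square A) /\
  (forall A B, A \in L -> B \in L -> A != B -> orthogonal_squares A B).

Definition complete_mols (q : nat) (Sym : finType) (L : {set 'M[Sym]_q}) :
  Prop := mols L /\ #|L| = q.-1.

Section MolsHypergraph.

Variables (h : nat) (Sym : finType).

Definition cell : finType := ('I_h.+1 * 'I_h.+1)%type.

Definition row_cells (i : 'I_h.+1) : {set cell} := [set c : cell | c.1 == i].

Definition col_cells (j : 'I_h.+1) : {set cell} := [set c : cell | c.2 == j].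

Definition symbol_cells (A : 'M[Sym]_h.+1) (s : Sym) : {set cell} :=
  [set c : cell | A c.1 c.2 == s].

Definition mols_edges (L : {set 'M[Sym]_h.+1}) : {set {set cell}} :=
  [set e : {set cell} | (#|e| == h) &&
    [|| [exists i, e \subset row_cells i],
        [exists j, e \subset col_cells j]
      | [exists A in L, exists s, e \subset symbol_cells A s]]].

Lemma mols_edges_uniform (L : {set 'M[Sym]_h.+1}) (e : {set cell}) :
  e \in mols_edges L -> #|e| = h.
Proof. by rewrite inE => /andP[/eqP]. Qed.

Definition mols_hypergraph (L : {set 'M[Sym]_h.+1}) : uhypergraph h cell :=
  UHypergraph (@mols_edges_uniform L).

End MolsHypergraph.

(* Main.v *)
(** The cells of the array, with the rows, the columns and the symbol classes
as lines, form an affine plane of order h+1.  Given T inside a pair S, some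
line l meets S exactly in T: the line through both points if T = S, one of
the row and the column of the point if T is a singleton, and a row missing
both points if T is empty.  As l has h+1 points, there is X in l \ T with h-1
points, and X |: [set z] lies in l for z in T.  As h-1 >= 2, l is the only
line containing X, so X |: [set s] is in no line for s in S \ T. *)

Require Import Defs.
From mathcomp Require Import all_boot all_algebra.

Set Implicit Arguments.
Unset Strict Implicit.
Unset Printing Implicit Defensive.

Lemma exists_subset_card (T : finType) (A : {set T}) (k : nat) :
  k <= #|A| -> exists2 B : {set T}, B \subset A & #|B| = k.
Proof.
rewrite -bin_gt0 -cards_draws => /card_gt0P[B].
by rewrite inE => /andP[sBA /eqP cB]; exists B.
Qed.

Section LatinSquares.

Variables (q : nat) (Sym : finType).
Implicit Types A B : 'M[Sym]_q.

Lemma latin_row_inj A i : latin_square A -> injective (A i).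
Proof.
case=> _ rowA _ j1 j2 eqA.
by have [j [_ uj]] := rowA i (A i j1); rewrite -(uj j1) // -(uj j2).
Qed.

Lemma latin_col_inj A j : latin_square A -> injective (A ^~ j).
Proof.
case=> _ _ colA i1 i2 eqA.
by have [i [_ ui]] := colA j (A i1 j); rewrite -(ui i1) // -(ui i2).
Qed.

(* Send A in L to the column of row i2 where A has its symbol of cell
   (i1, j1).  By orthogonality this is injective, and it misses j1; as L has
   q - 1 members, it reaches every other column. *)
Lemma complete_mols_same_symbol (L : {set 'M[Sym]_q}) (i1 i2 j1 j2 : 'I_q) :
    complete_mols L -> i1 != i2 -> j1 != j2 ->
  exists2 A, A \in L & A i1 j1 = A i2 j2.
Proof.
move=> [[latL orthL] cardL] ni nj.
(* The default [j1] is never returned for [A] in [L]: row [i2] of a Latin square contains every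
   symbol. *)
pose f A := odflt j1 [pick j | A i2 j == A i1 j1].
have fP A : A \in L -> A i2 (f A) = A i1 j1.
  move=> /latL[_ rowA _]; rewrite /f; case: pickP => [j /eqP //|].
  by have [j [/eqP eqj _]] := rowA i2 (A i1 j1) => /(_ j); rewrite eqj.
have injf : {in L &, injective f}.
  move=> A B LA LB eqf; apply/eqP/negPn/negP => nAB.
  (* If [f A = f B], the cells [(i2, f A)] and [(i1, j1)] carry the same pair of symbols in [A] and
     [B], so orthogonality would force [i2 = i1]. *)
  have /(_ (i2, f A) (i1, j1)) := orthL A B LA LB nAB.
  rewrite /= fP // {1}eqf fP // => /(_ erefl)[eqi _].
  by rewrite eqi eqxx in ni.
have fsub : f @: L \subset [set~ j1].
  apply/subsetP => _ /imsetP[A LA ->]; rewrite !inE; apply: contraNneq ni => fj1.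
  by apply/eqP/(latin_col_inj (latL A LA) (j := j1)); rewrite -[in RHS]fj1 fP.
have fimg : f @: L = [set~ j1].
  by apply/eqP; rewrite eqEcard fsub cardsC1 card_ord card_in_imset ?cardL /=.
have : j2 \in f @: L by rewrite fimg !inE eq_sym.
by case/imsetP=> A LA ->; exists A; rewrite ?fP.
Qed.

End LatinSquares.

Section AffinePlane.

Variables (h : nat) (Sym : finType) (L : {set 'M[Sym]_h.+1}).
Implicit Types (l e S T : {set cell h}) (x y : cell h).

(** The lines of the affine plane. As each has [h.+1] points, an edge is a line with one point
    removed. *)
Variant mols_line : {set cell h} -> Prop :=
| RowLine i : mols_line (row_cells i)
| ColLine j : mols_line (col_cells j)
| SymbolLine A s of A \in L : mols_line (symbol_cells A s).

Lemma mols_edgesP e :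
  reflect (#|e| = h /\ exists2 l, mols_line l & e \subset l)
          (e \in mols_edges L).
Proof.
rewrite inE; apply: (iffP andP) => [[/eqP ce el]|[ce [l ll el]]].
  split=> //; case/or3P: el => [/existsP[i]|/existsP[j]|].
  - by exists (row_cells i); first exact: RowLine.
  - by exists (col_cells j); first exact: ColLine.
  - case/existsP=> A /andP[LA /existsP[s el]].
    by exists (symbol_cells A s); first exact: SymbolLine.
split; first exact/eqP.
case: ll el => [i|j|A s LA] el; apply/or3P.
- by apply: Or31; apply/existsP; exists i.
- by apply: Or32; apply/existsP; exists j.
- apply: Or33; apply/existsP; exists A; rewrite LA /=.
  by apply/existsP; exists s.
Qed.

Hypothesis molsL : mols L.

Lemma card_mols_line l : mols_line l -> #|l| = h.+1.
Proof.
case=> [i|j|A s LA].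
- rewrite -[RHS]card_ord -(card_imset predT (f := pair i)) => [|j j' [] //].
  apply: eq_card => -[i' j]; rewrite inE /=.
  by apply/eqP/imsetP => [->|[j' _ []]//]; exists j.
- rewrite -[RHS]card_ord -(card_imset predT (f := pair^~ j)) => [|i i' [] //].
  apply: eq_card => -[i j']; rewrite inE /=.
  by apply/eqP/imsetP => [->|[i' _ []]//]; exists i.
- have latA := molsL.1 A LA.
  have [_ rowA _] := latA.
  rewrite -[RHS]card_ord -[RHS]cardsT.
  (* Projection to the row index is a bijection from a symbol class to ['I_h.+1]: each row contains
     [s] exactly once. *)
  have <- : fst @: symbol_cells A s = setT.
    apply/setP => i; rewrite inE; have [j [Aij _]] := rowA i s.
    by apply/imsetP; exists (i, j); rewrite ?inE /= ?Aij.
  rewrite card_in_imset // => -[i j] [i' j']; rewrite !inE /=.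
  move=> /eqP eqs /eqP eqs' eqi; move: eqs'; rewrite -eqi -eqs.
  by move/(latin_row_inj latA) ->.
Qed.

(** Distinct lines of one kind, or of one square, are disjoint. A row and a column share one cell,
    either meets a symbol class once by the Latin property, and classes of two different squares
    share at most one cell by orthogonality. *)
Lemma mols_line_unique l l' x y :
    mols_line l -> mols_line l' -> x != y ->
    x \in l -> y \in l -> x \in l' -> y \in l' -> l = l'.
Proof.
case: molsL x y => latL orthL [i1 j1] [i2 j2] ll ll' nxy.
case: ll => [i|j|A s LA]; case: ll' => [i'|j'|A' s' LA']; rewrite !inE /=.
- by do ![move/eqP <-].
- by do ![move/eqP=> ?]; subst; rewrite eqxx in nxy.
- do ![move/eqP=> ?]; subst.
  have /(latin_row_inj (latL _ LA')) eqj : A' i j2 = A' i j1 by [].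
  by rewrite eqj eqxx in nxy.
- by do ![move/eqP=> ?]; subst; rewrite eqxx in nxy.
- by do ![move/eqP <-].
- do ![move/eqP=> ?]; subst.
  have /(latin_col_inj (latL _ LA')) eqi : A' i2 j = A' i1 j by [].
  by rewrite eqi eqxx in nxy.
- do ![move/eqP=> ?]; subst.
  have /(latin_row_inj (latL _ LA)) eqj : A i' j2 = A i' j1 by [].
  by rewrite eqj eqxx in nxy.
- do ![move/eqP=> ?]; subst.
  have /(latin_col_inj (latL _ LA)) eqi : A i2 j' = A i1 j' by [].
  by rewrite eqi eqxx in nxy.
- have [<-|nA] := eqVneq A A'; first by do ![move/eqP <-].
  move=> /eqP e1 /eqP e2 /eqP e3 /eqP e4; case/eqP: nxy.
  by apply: (orthL A A' LA LA' nA); rewrite /= e1 e2 e3 e4.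
Qed.

Lemma mols_line_separating x y :
  x != y -> exists2 l, mols_line l & (x \in l) && (y \notin l).
Proof.
case: x y => i1 j1 [i2 j2] nxy; have [eqi|ni] := eqVneq i1 i2.
  exists (col_cells j1); first exact: ColLine.
  by rewrite !inE eqxx /=; apply: contraNneq nxy => <-; rewrite eqi.
exists (row_cells i1); first exact: RowLine.
by rewrite !inE eqxx /= eq_sym.
Qed.

(** The points of [S] occupy at most [h] of the [h.+1] rows, so some row is free. *)
Lemma mols_line_avoiding S :
  #|S| <= h -> exists2 l, mols_line l & [disjoint l & S].
Proof.
move=> cS; have /subsetPn[i _ niS] : ~~ (setT \subset fst @: S).
  apply/negP => /subset_leq_card; rewrite cardsT card_ord => /leq_trans.
  by move/(_ _ (leq_imset_card _ _)); rewrite ltnNge cS.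
exists (row_cells i); first exact: RowLine.
rewrite disjoints_subset; apply/subsetP => x; rewrite !inE => /eqP xi.
by apply: contra niS => Sx; rewrite -xi imset_f.
Qed.

End AffinePlane.

(** Completeness enters here: two cells in different rows and columns need a square of [L] that
    gives them the same symbol. *)
Lemma complete_mols_line_through (h : nat) (Sym : finType)
    (L : {set 'M[Sym]_h.+1}) (x y : cell h) :
    complete_mols L ->
  exists2 l, mols_line L l & (x \in l) && (y \in l).
Proof.
case: x y => i1 j1 [i2 j2] cL; have [<-|ni] := eqVneq i1 i2.
  by exists (row_cells i1); [exact: RowLine | rewrite !inE /= eqxx].
have [<-|nj] := eqVneq j1 j2.
  by exists (col_cells j1); [exact: ColLine | rewrite !inE /= eqxx].
have [A LA eqA] := complete_mols_same_symbol cL ni nj.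
exists (symbol_cells A (A i1 j1)); first exact: SymbolLine.
by rewrite !inE /= eqxx eqA eqxx.
Qed.

Lemma complete_mols_line_trace (h : nat) (Sym : finType)
    (L : {set 'M[Sym]_h.+1}) (S T : {set cell h}) :
    2 <= h -> complete_mols L -> #|S| = 2 -> T \subset S ->
  exists2 l, mols_line L l & l :&: S = T.
Proof.
move=> h2 cL cS sTS; have /eqP/cards2P[x [y [nxy defS]]] := cS.
suff: exists2 l, mols_line L l &
    ((x \in l) == (x \in T)) && ((y \in l) == (y \in T)).
  case=> l ll /andP[xl yl]; exists l => //; apply/setP => z; rewrite inE.
  have [zS|zS] := boolP (z \in S); last first.
    by rewrite andbF; apply/esym/negbTE; apply: contra zS; apply/subsetP.
  by rewrite andbT; move: zS; rewrite defS !inE => /orP[] /eqP ->; apply/eqP.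
case: (x \in T); case: (y \in T).
- have [l ll /andP[xl yl]] := complete_mols_line_through x y cL.
  by exists l; rewrite ?xl ?yl.
- have [l ll /andP[xl yl]] := mols_line_separating L nxy.
  by exists l; rewrite ?xl ?(negbTE yl).
- rewrite eq_sym in nxy.
  have [l ll /andP[yl xl]] := mols_line_separating L nxy.
  by exists l; rewrite ?(negbTE xl) ?yl.
- have cSh : #|S| <= h by rewrite cS.
  have [l ll dlS] := mols_line_avoiding L cSh.
  by exists l; rewrite ?(disjointFl dlS) // defS !inE eqxx ?orbT.
Qed.

Theorem theorem8 (h : nat) (Sym : finType) (L : {set 'M[Sym]_h.+1})
  (h_ge3 : 3 <= h) (L_complete : complete_mols L) :
  n_ec 2 (mols_hypergraph L).
Proof.
move=> S T cS sTS; have molsL := L_complete.1.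
have [l ll lST] := complete_mols_line_trace (ltnW h_ge3) L_complete cS sTS.
have sTl : T \subset l by rewrite -lST subsetIl.
(* There is room for [X] because [#|T| <= 2] leaves at least [h.+1 - 2 = h.-1] points in
   [l :\: T]. *)
have [X sXlT cX] : exists2 X : {set cell h}, X \subset l :\: T & #|X| = h.-1.
  apply: exists_subset_card; rewrite cardsDS // (card_mols_line molsL ll).
  by rewrite -subn1 -subSS leq_sub2l // -cS subset_leq_card.
have sXl : X \subset l := subset_trans sXlT (subsetDl l T).
(* A point of [l] in [S] would lie in [T], which [X] avoids. *)
have sXS : X \subset ~: S.
  apply/subsetP => x Xx; rewrite inE; apply: contraL (subsetP sXlT x Xx) => Sx.
  by rewrite !inE -lST inE Sx andbT andNb.
exists X; split=> // [z Tz | s]; last first.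
  rewrite inE => /andP[nTs Ss]; apply/mols_edgesP => -[_ [l' ll']].
  rewrite subUset sub1set => /andP[sXl' sl'].
  have /card_gt1P[x [y [Xx Xy nxy]]] : 1 < #|X|.
    by rewrite cX -ltnS (ltn_predK h_ge3).
  (* Once [l' = l], the point [s] is in [l :&: S = T], a contradiction. *)
  have eql : l = l'.
    by apply: (mols_line_unique molsL ll ll' nxy);
      by [apply: (subsetP sXl) | apply: (subsetP sXl')].
  by rewrite -lST inE Ss eql sl' in nTs.
apply/mols_edgesP; split; last first.
  by exists l; rewrite // subUset sXl sub1set (subsetP sTl).
have nXz : z \notin X.
  by apply: contraL Tz => /(subsetP sXlT); rewrite inE => /andP[].
by rewrite setUC cardsU1 nXz cX add1n (ltn_predK h_ge3).
Qed.
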